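(* Let $H$ be a $G_\phi$-graph with $m$ leaves, and let $A$ be a set of positive integers with $G_\phi(A)=H$. Then $|A|\ge m-1$.
   Context: $\phi$ denotes Euler's totient function, $\phi^0(n)=n$ and $\phi^i(n)=\phi(\phi^{i-1}(n))$. For a set $A$ of positive integers, $A_\phi=\{\phi^k(n): n\in A,\ k\ge 0\}$, and $G_\phi(A)$ is the simple graph with vertex set $A_\phi$ in which distinct vertices $r,s$ are adjacent iff $\phi(r)=s$ or $\phi(s)=r$. A graph $H$ is a $G_\phi$-graph if $H=G_\phi(A)$ for some set $A$ of positive integers. A leaf is a vertex of degree $1$. *)

(* Defs.v *)
From mathcomp Require Import all_boot.
From mathcomp Require Import boolp classical_sets functions cardinality.

Set Implicit Arguments.
Unset Strict Implicit.
Unset Printing Implicit Defensive.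

Local Open Scope classical_set_scope.
Local Open Scope card_scope.

(* Possibly infinite simple graphs with vertices taken from T. The fields from
   [adj_sym] on are proofs, so by propositional extensionality two graphs are
   equal as soon as they have the same vertices and the same adjacency. *)
Record sgraph (T : Type) := SGraph {
  vertices : set T;
  adj : T -> T -> Prop;
  adj_sym : forall x y, adj x y -> adj y x;
  adj_irrefl : forall x, ~ adj x x;
  adj_vertices : forall x y, adj x y -> vertices x
}.

Definition neighbours (T : Type) (G : sgraph T) (v : T) : set T :=
  [set w | adj G v w].

Definition leaves (T : Type) (G : sgraph T) : set T :=
  [set v | vertices G v /\ neighbours G v #= `I_1].

Definition positive_set (A : set nat) : Prop := forall n, A n -> 0 < n.

Definition phi_closure (A : set nat) : set nat :=
  [set x | exists n k, A n /\ x = iter k totient n].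

Definition Gphi_adj (A : set nat) (r s : nat) : Prop :=
  [/\ phi_closure A r, phi_closure A s, r <> s
    & totient r = s \/ totient s = r].

Lemma Gphi_adj_sym A r s : Gphi_adj A r s -> Gphi_adj A s r.
Proof. by move=> [Ar As nrs e]; split=> //; [exact: nesym | case: e; [right|left]]. Qed.

Lemma Gphi_adj_irrefl A r : ~ Gphi_adj A r r.
Proof. by case. Qed.

Lemma Gphi_adj_vertices A r s : Gphi_adj A r s -> phi_closure A r.
Proof. by case. Qed.

Definition Gphi (A : set nat) : sgraph nat :=
  SGraph (@Gphi_adj_sym A) (@Gphi_adj_irrefl A) (@Gphi_adj_vertices A).

Definition is_Gphi_graph (H : sgraph nat) : Prop :=
  exists A : set nat, positive_set A /\ H = Gphi A.

(* Main.v *)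
(* Totients are smaller than their argument above 1, so a vertex v <> 1 that is
   not in A has two distinct neighbours: totient v < v, and a preimage of v,
   which exceeds v. Hence every leaf other than 1 belongs to A. *)
Require Import Defs.
From mathcomp Require Import all_boot.
From mathcomp Require Import boolp classical_sets functions cardinality.

Local Open Scope classical_set_scope.
Local Open Scope card_scope.

(** [totient n] counts the [d < n] coprime to [n]; for [n > 1] the term [d = 0] vanishes since
    [gcdn n 0 = n], which leaves [n - 1] terms, each at most 1. *)
Lemma totient_ltn n : 1 < n -> totient n < n.
Proof.
move=> n_gt1; have n_gt0 := ltnW n_gt1.
rewrite totient_count_coprime big_ltn // /coprime gcdn0 (gtn_eqF n_gt1) add0n.
have /leq_ltn_trans -> // : \sum_(1 <= d < n) coprime n d <= n.-1.
  rewrite -subn1 -[leqRHS]muln1 -sum_nat_const_nat.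
  by apply: leq_sum => d _; apply: leq_b1.
by rewrite prednK.
Qed.

Lemma phi_closure_totient (A : set nat) n :
  phi_closure A n -> phi_closure A (totient n).
Proof. by move=> [a [k [Aa ->]]]; exists a, k.+1. Qed.

Lemma phi_closure_gt0 (A : set nat) n :
  positive_set A -> phi_closure A n -> 0 < n.
Proof.
move=> Apos [a [k [Aa ->]]]; elim: k => [|k IHk] /=; first exact: Apos.
by rewrite totient_gt0.
Qed.

Lemma card_eq1_inj (T : Type) (B : set T) x y :
  B #= `I_1 -> B x -> B y -> x = y.
Proof.
move=> /eq_cardSP[z _]; rewrite II0 card_eq0 => /eqP B0.
have eqz w : B w -> w = z.
  by move=> Bw; apply: contrapT => wz; have : set0 w by rewrite -B0; split.
by move=> /eqz -> /eqz ->.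
Qed.

(** The vertex 1 is its own totient, so it can be a leaf outside [A], as for [A = {2}]; this
    accounts for the loss of one in the bound. *)
Lemma leaves_Gphi_subset (A : set nat) :
  positive_set A -> leaves (Gphi A) `\ 1 `<=` A.
Proof.
move=> Apos v [[Vv leafv] v1].
have v_gt1 : 1 < v.
  by rewrite ltn_neqAle (phi_closure_gt0 _ _ Apos Vv) andbT; apply/eqP => /esym.
have := Vv; move=> [a [[|k] [Aa]]] /= vE; first by rewrite vE.
set u := iter k totient a in vE.
have Vu : phi_closure A u by exists a, k.
have vu : v < u.
  have u_gt0 := phi_closure_gt0 _ _ Apos Vu.
  (* Here [v = totient u], and [u = 1] would force [v = 1]. *)
  case: (ltngtP u 1) => [||u1]; first by rewrite ltnNge u_gt0.
    by rewrite vE; exact: totient_ltn.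
  by move: v_gt1; rewrite vE u1.
have tv := totient_ltn _ v_gt1.
have Nt : neighbours (Gphi A) v (totient v).
  split=> //; [exact: phi_closure_totient | | by left].
  by move=> e; rewrite -e ltnn in tv.
have Nu : neighbours (Gphi A) v u.
  split=> //; [by move=> e; rewrite -e ltnn in vu | by right].
have e := card_eq1_inj _ _ _ _ leafv Nt Nu.
by move: (ltn_trans tv vu); rewrite e ltnn.
Qed.

Lemma card_le_setD1 (T : Type) (B : set T) (x : T) (m : nat) :
  B #= `I_m -> `I_(m - 1) #<= B `\ x.
Proof.
move=> Bm; have [Bx|nBx] := pselect (B x); last first.
  rewrite not_setD1 // (card_le_eqr Bm) card_le_II; exact: leq_subr.
have /finite_setP[q Bq] : finite_set (B `\ x).
  by apply: finite_setD; apply/finite_setP; exists m.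
(* Putting [x] back into [B] minus [x] gives [q + 1] elements, so [m = q + 1]. *)
have /card_eq_II -> : `I_m #= `I_q.+1.
  by rewrite -(card_eql Bm); apply/eq_cardSP; exists x.
by rewrite subSS subn0 (card_le_eqr Bq).
Qed.

(** For an infinite cardinal [m - 1 = m], so the second conjunct has no loss of one. *)
Theorem theorem2p14 (H : sgraph nat) (A : set nat) :
  is_Gphi_graph H -> positive_set A -> Gphi A = H ->
  (forall m : nat, leaves H #= `I_m -> `I_(m - 1) #<= A) /\
  (infinite_set (leaves H) -> leaves H #<= A).
Proof.
move=> _ Apos <-; have LA := subset_card_le (leaves_Gphi_subset _ Apos).
split=> [m Lm|Linf]; first exact: card_le_trans (card_le_setD1 _ _ 1 _ Lm) LA.
(* The leaves are natural numbers, so it suffices to embed all of [nat] into the leaves other than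
   1, still an infinite set. *)
apply: card_le_trans (card_leT _) _; apply: card_le_trans LA.
by apply/infiniteP; apply: infinite_setD.
Qed.
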